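(* Let $X$ and $Y$ be random variables with probability mass functions $f$ and $g$ respectively, both supported on the same set, which is either $\mathbf{Z}_+=\{0,1,2,\ldots\}$ or $\{0,1,\ldots,n\}$ for some integer $n>0$ (i.e. $f$ and $g$ are strictly positive exactly on this set). Assume $X\leq_{lc}Y$. Then: 1. $X\leq_{st}Y$ and $X\leq_{hr}Y$ are equivalent, and each holds if and only if $f(0)/g(0)\geq 1$. 2. $X\leq_{lr}Y$ and $X\leq_{rh}Y$ are equivalent, and each holds if and only if $f(1)/g(1)\leq f(0)/g(0)$.
   Context: Let $X,Y$ be integer-valued with pmfs $f,g$ and cumulative distribution functions $F,G$, and put $\bar F(x)=1-F(x)=\Pr(X>x)$, $\bar G(x)=1-G(x)=\Pr(Y>x)$. By convention $a/0=\infty$ whenever $a>0$. Usual stochastic order: $X\leq_{st}Y$ if $\bar F(x)\leq\bar G(x)$ for all $x$. Hazard rate order: $X\leq_{hr}Y$ if $f(x)/\bar F(x)\geq g(x)/\bar G(x)$ for all $x$ in the common support. Reversed hazard rate order: $X\leq_{rh}Y$ if $f(x)/F(x)\leq g(x)/G(x)$ for all $x$ in the common support. Likelihood ratio order: $X\leq_{lr}Y$ if $f(x)/g(x)$ is a monotone decreasing (i.e. non-increasing) function on $\{x: f(x)>0\text{ or }g(x)>0\}$. Relative log-concavity order: $X\leq_{lc}Y$ if $\mathrm{supp}(X)=\{x:f(x)>0\}$ and $\mathrm{supp}(Y)=\{x:g(x)>0\}$ are both intervals of $\mathbf{Z}$, $\mathrm{supp}(X)\subset\mathrm{supp}(Y)$,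 and $\log(f(x)/g(x))$ is a concave function on $\mathrm{supp}(X)$ (concavity of a function $u$ on an integer interval means $2u(x)\geq u(x-1)+u(x+1)$ whenever $x-1,x,x+1$ lie in the interval). *)

(* Defs.v *)
From HB Require Import structures.
From mathcomp Require Import all_boot all_order all_algebra.
From mathcomp Require Import all_classical all_reals all_analysis.

Set Implicit Arguments.
Unset Strict Implicit.
Unset Printing Implicit Defensive.

Import Order.TTheory GRing.Theory Num.Theory.

Local Open Scope classical_set_scope.
Local Open Scope ring_scope.

(* Integer-valued random variables are rendered as real random variables X with
   X t \is a Num.int for all t; integers enter pmf, cdf and ccdf through the
   injection _%:~R. Ratios that may have denominator 0 are taken in \bar R,
   where 0^-1 = +oo and hence a / 0 = +oo for a > 0. *)

Section IntegerValued.
Context d (T : measurableType d) (R : realType) (P : probability T R).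

Definition integer_valued (X : {RV P >-> R}) : Prop :=
  forall t, X t \is a Num.int.

Definition pmfz (X : {RV P >-> R}) (x : int) : R := pmf X x%:~R.

Definition supp (X : {RV P >-> R}) : set int := [set x | 0 < pmfz X x].

End IntegerValued.

Definition concave_on (R : realType) (A : set int) (u : int -> R) : Prop :=
  forall x : int, A (x - 1) -> A x -> A (x + 1) ->
    u (x - 1) + u (x + 1) <= 2 * u x.

Section Orders.
Context d1 d2 (T1 : measurableType d1) (T2 : measurableType d2) (R : realType).
Context (P : probability T1 R) (Q : probability T2 R).

Definition st_le (X : {RV P >-> R}) (Y : {RV Q >-> R}) : Prop :=
  forall x : R, (ccdf X x <= ccdf Y x)%E.

Definition hr_le (X : {RV P >-> R}) (Y : {RV Q >-> R}) : Prop :=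
  forall x : int, (supp X `&` supp Y) x ->
    ((pmfz Y x)%:E / ccdf Y x%:~R <= (pmfz X x)%:E / ccdf X x%:~R)%E.

Definition rh_le (X : {RV P >-> R}) (Y : {RV Q >-> R}) : Prop :=
  forall x : int, (supp X `&` supp Y) x ->
    ((pmfz X x)%:E / cdf X x%:~R <= (pmfz Y x)%:E / cdf Y x%:~R)%E.

Definition lr_le (X : {RV P >-> R}) (Y : {RV Q >-> R}) : Prop :=
  forall x y : int, (supp X `|` supp Y) x -> (supp X `|` supp Y) y -> x <= y ->
    ((pmfz X y)%:E / (pmfz Y y)%:E <= (pmfz X x)%:E / (pmfz Y x)%:E)%E.

Definition lc_le (X : {RV P >-> R}) (Y : {RV Q >-> R}) : Prop :=
  [/\ is_interval (supp X), is_interval (supp Y), supp X `<=` supp Y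
    & concave_on (supp X) (fun x => ln (pmfz X x / pmfz Y x))].

End Orders.

(* Main.v *)
Require Import Defs.
From HB Require Import structures.
From mathcomp Require Import all_boot all_order all_algebra.
From mathcomp Require Import all_classical all_reals all_analysis.
From mathcomp Require Import zify lra.

(** Everything is read off the ratio r = f / g on the common support S, an
    integer interval that starts at 0 and contains 1.  Log-concavity of r is
    used through two consequences:
    - r is quasi-concave: it is at least min (r x) (r z) between x and z
      ([ratio_quasiconcave]);
    - once r fails to increase at one step, it never increases again
      ([ratio_nonincreasing]).
    They are turned into statements on distribution functions by summation: a
    bound r <= c, or c <= r, on the points of S in a Borel set B gives the same
    bound between Pr(X in B) and c Pr(Y in B) ([pr_le_ratio], [pr_ge_ratio]).
    Both marginal functions F and 1 - F are such probabilities, which treats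
    finite and infinite supports alike.

    First part.  Each of the two orders, looked at in 0 where 1 - F = 1 - f 0
    and 1 - G = 1 - g 0, says that f 0 >= g 0.  Assume conversely r 0 >= 1.

    For the usual stochastic order at x: if r <= 1 everywhere beyond x, summing
    beyond x compares the tails.  Otherwise r z > 1 for some z > x, and
    quasi-concavity between 0 and z gives r >= 1 up to x; summing up to x
    compares the distribution functions.

    For the hazard rate order at x, which says that 1 - F <= r x (1 - G) in x:
    if r <= r x beyond x, sum beyond x.  Otherwise r z > r x for some z > x, so
    quasi-concavity gives r x >= r 0 >= 1, and 1 - F <= 1 - G was just proved.

    Second part.  If r 1 <= r 0 then r is nonincreasing on S, which is the
    likelihood ratio order; summing r x <= r up to x gives r x G x <= F x, which
    is the reversed hazard rate order; and the latter in x = 1, where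
    F = f 0 + f 1 and G = g 0 + g 1, simplifies to r 1 <= r 0. *)

Set Implicit Arguments.
Unset Strict Implicit.
Unset Printing Implicit Defensive.

Import Order.TTheory GRing.Theory Num.Theory.

Local Open Scope classical_set_scope.
Local Open Scope ring_scope.

(** * Concave functions on an integer interval *)

Section ConcaveOnInterval.
Context (R : realType) (A : set int) (u : int -> R).
Hypotheses (itvA : is_interval A) (concA : concave_on A u).

(** The increments of a concave function are nonincreasing, so a nonpositive
    one is followed by nonpositive ones only. *)
Lemma concave_descent x y : A x -> A (x + 1) -> u (x + 1) <= u x ->
  x <= y -> A (y + 1) -> u (y + 1) <= u y.
Proof.
move=> Ax Ax1 ux xy.
have {xy} -> : y = x + `|y - x|%N%:Z by lia.
elim: `|y - x|%N => [|k IHk] Ay1; first by rewrite !addr0.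
have Ak (i : int) : 0 <= i <= k.+2%:Z -> A (x + i).
  by move=> ?; apply: (itvA Ax Ay1); lia.
have e1 : x + k.+1%:Z - 1 = x + k by lia.
have e2 : x + k + 1 = x + k.+1%:Z by lia.
have := @concA (x + k.+1%:Z); rewrite e1 => /(_ (Ak _ _) (Ak _ _) Ay1).
have := IHk; rewrite e2 => /(_ (Ak _ _)).
move=> /(_ ltac:(lia)) uk /(_ ltac:(lia) ltac:(lia)); lra.
Qed.

Lemma concave_nonincreasing x y z : A x -> A (x + 1) -> u (x + 1) <= u x ->
  A z -> x <= y -> y <= z -> u z <= u y.
Proof.
move=> Ax Ax1 ux Az xy yz.
have main k : y + k%:Z <= z -> u (y + k%:Z) <= u y.
  elim: k => [|k IHk] kz; first by rewrite addr0.
  apply: le_trans (IHk ltac:(lia)).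
  have yk : y + k.+1%:Z = y + k%:Z + 1 by lia.
  rewrite yk in kz *; apply: (concave_descent Ax Ax1 ux); first by lia.
  by apply: (itvA Ax Az); lia.
have ez : z = y + `|z - y|%N%:Z by lia.
by rewrite ez; apply: main; rewrite -ez.
Qed.

(** If [u] dropped at a step on the way from [x] to [y], it would be
    nonincreasing from there on, which excludes [u y < u z].  So [u] increases
    at each step from [x] to [y]. *)
Lemma concave_quasiconcave x y z : A x -> A z -> x <= y -> y <= z ->
  u y < u z -> u x <= u y.
Proof.
move=> Ax Az xy yz uyz.
have y_lt_z : y < z.
  by rewrite lt_neqAle yz andbT; apply: contraTneq uyz => ->; rewrite ltxx.
(* The steps are taken backwards from y, so that the bound to prove at each
   of them is u y. *)
have main k : x <= y - k%:Z -> u (y - k%:Z) <= u y.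
  elim: k => [|k IHk] kx; first by rewrite subr0.
  apply: le_trans (IHk ltac:(lia)).
  rewrite leNgt; apply/negP => /ltW.
  have -> : y - k%:Z = (y - k.+1%:Z) + 1 by lia.
  have Aw : A (y - k.+1%:Z) by apply: (itvA Ax Az); lia.
  have Aw1 : A (y - k.+1%:Z + 1) by apply: (itvA Ax Az); lia.
  move=> /(concave_nonincreasing Aw Aw1) /(_ Az) uyz'.
  by move: uyz; rewrite ltNge uyz'//; lia.
have ex : x = y - `|y - x|%N%:Z by lia.
by rewrite {1}ex; apply: main; rewrite -ex.
Qed.
End ConcaveOnInterval.

(** * Probabilities of events as sums of point masses *)

(** The conventions [a / 0 = +oo] for [0 < a] and [+oo <= +oo] are exactly what
    makes cross-multiplication valid for zero denominators too: with [d = 0]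
    both sides hold, with [b = 0 < d] both fail. *)
Lemma lee_pdiv_cross (R : realType) (a b c d : R) :
  0 < a -> 0 <= b -> 0 < c -> 0 <= d ->
  (a%:E / b%:E <= c%:E / d%:E)%E = (a * d <= c * b).
Proof.
move=> a0 b0 c0 d0; have [->|dn0] := eqVneq d 0.
  by rewrite inve0 gt0_muley ?lte_fin// leey mulr0 mulr_ge0// ltW.
have {d0 dn0}d0 : 0 < d by rewrite lt_def dn0.
have [->|bn0] := eqVneq b 0.
  rewrite inve0 gt0_muley ?lte_fin// mulr0 [RHS]leNgt mulr_gt0//=.
  by rewrite inver gt_eqF// -EFinM leye_eq.
have {b0 bn0}b0 : 0 < b by rewrite lt_def bn0.
rewrite !inver !gt_eqF// -!EFinM lee_fin.
by rewrite ler_pdivrMr// mulrAC ler_pdivlMr.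
Qed.

Section IntegerLaw.
Context (R : realType).

(** Real-valued, since probabilities are finite: inequalities between tails and
    distribution functions then become linear arithmetic over [R]. *)
Definition pr d (T : measurableType d) (P : probability T R)
  (X : {RV P >-> R}) (B : set R) : R := fine (distribution P X B).

Section OneVariable.
Context d (T : measurableType d) (P : probability T R) (X : {RV P >-> R}).

Lemma pr_ge0 B : 0 <= pr X B. Proof. exact: fine_ge0. Qed.

Lemma prE B : measurable B -> distribution P X B = (pr X B)%:E.
Proof. by move=> mB; rewrite /pr fineK// fin_num_measure. Qed.

Lemma cdfE x : cdf X x = (pr X `]-oo, x])%:E.
Proof. exact: prE. Qed.

Lemma ccdfE x : ccdf X x = (pr X `]x, +oo[)%:E.
Proof. exact: prE. Qed.

Lemma pmfz_ge0 k : 0 <= pmfz X k. Proof. exact: pmf_ge0. Qed.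

Lemma prU A B : measurable A -> measurable B -> A `&` B = set0 ->
  pr X (A `|` B) = pr X A + pr X B.
Proof.
move=> mA mB AB; apply: EFin_inj; rewrite EFinD -!prE//; last exact: measurableU.
exact: measureU.
Qed.

Lemma pr_cdf_ccdf x : pr X `]-oo, x] + pr X `]x, +oo[ = 1.
Proof. by apply: EFin_inj; rewrite EFinD -cdfE -ccdfE cdf_ccdf_1. Qed.

Hypothesis Xint : integer_valued X.

(** The integers are enumerated by [pickle] because series are indexed by [nat];
    the default value of [odflt] is never reached for indices in the range of
    [pickle]. *)
Lemma pr_eseries B : measurable B ->
  (pr X B)%:E = (\sum_(n <oo | n \in [set pickle k | k in [set k : int | B k%:~R]])
     (pmfz X (odflt 0 (unpickle n)))%:E)%E.
Proof.
move=> mB.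
pose F n := X @^-1` [set ((odflt 0 (unpickle n))%:~R : R) : R].
have mF n : measurable (F n) by exact: measurable_funPTI.
rewrite -prE//.
transitivity (P (\bigcup_(n in [set pickle k | k in [set k : int | B k%:~R]]) F n)).
  congr (P _); apply/seteqP; split => [t Bt|t [_ [k /= Bk <-]]].
    have /intrP[k Xk] := Xint t.
    exists (pickle k); first by exists k => //=; rewrite -Xk.
    by rewrite /F/= pickleK.
  by rewrite /F/= pickleK/= => ->.
rewrite measure_bigcup//.
  by apply: eq_eseriesr => n _; rewrite /pmfz /pmf fineK// fin_num_measure.
move=> _ _ [k _ <-] [l _ <-] [t []]; rewrite /F/= !pickleK/= => -> /intr_inj.
by move=> ->.
Qed.

End OneVariable.

(** Termwise comparison of the two series.  The scalars stand on both sides so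
    that the lemma gives upper and lower bounds alike, and, with [b = 0], the
    vanishing of the probability of an event that carries no mass. *)
Lemma pr_le_pr d1 d2 (T1 : measurableType d1) (T2 : measurableType d2)
    (P : probability T1 R) (Q : probability T2 R)
    (X : {RV P >-> R}) (Y : {RV Q >-> R}) (a b : R) (B : set R) :
  integer_valued X -> integer_valued Y -> 0 <= a -> measurable B ->
  (forall k : int, B k%:~R -> a * pmfz X k <= b * pmfz Y k) ->
  a * pr X B <= b * pr Y B.
Proof.
move=> Xint Yint a0 mB ab; rewrite -lee_fin !EFinM !pr_eseries//.
rewrite -!nneseriesZl; [|by move=> *; rewrite lee_fin pmfz_ge0..].
apply: lee_nneseries => [n _ _|n /set_mem[k /= Bk <-]].
  by rewrite mule_ge0 ?lee_fin ?pmfz_ge0.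
by rewrite pickleK/= -!EFinM lee_fin ab.
Qed.

Lemma pr_eq0 d (T : measurableType d) (P : probability T R)
    (X : {RV P >-> R}) (B : set R) : integer_valued X -> measurable B ->
  (forall k : int, B k%:~R -> pmfz X k = 0) -> pr X B = 0.
Proof.
move=> Xint mB B0; apply/le_anti; rewrite pr_ge0 andbT.
have := @pr_le_pr _ _ _ _ _ _ X X 1 0 B Xint Xint ler01 mB.
by rewrite mul1r mul0r; apply => k /B0 ->; rewrite mul1r mul0r.
Qed.

(** The interval from [k] to [k + 1] contains no integer in its interior. *)
Lemma pr_rayS d (T : measurableType d) (P : probability T R)
    (X : {RV P >-> R}) (k : int) : integer_valued X ->
  pr X `]-oo, (k + 1)%:~R] = pr X `]-oo, k%:~R] + pmfz X (k + 1).
Proof.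
move=> Xint.
have -> : [set` `]-oo, (k + 1)%:~R]] = `]-oo, k%:~R] `|` `]k%:~R, (k + 1)%:~R] :> set R.
  by rewrite -itv_bndbnd_setU// bnd_simp ler_int; lia.
rewrite prU//; last first.
  apply/seteqP; split => // t [/=]; rewrite !in_itv/=; lra.
congr (_ + _).
have -> : [set` `]k%:~R, (k + 1)%:~R]] = `]k%:~R, (k + 1)%:~R[ `|` [set (k + 1)%:~R] :> set R.
  by rewrite setUitv1// bnd_simp ltr_int; lia.
rewrite prU//; last first.
  by apply/seteqP; split => // t [/=]; rewrite in_itv/= => /andP[_] + tk; rewrite tk ltxx.
rewrite pr_eq0// ?add0r// => i /=; rewrite in_itv/= !ltr_int; lia.
Qed.

Lemma pr_ray0 d (T : measurableType d) (P : probability T R)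
    (X : {RV P >-> R}) : integer_valued X -> (forall k, supp X k -> 0 <= k) ->
  pr X `]-oo, 0] = pmfz X 0.
Proof.
move=> Xint X0; have := pr_rayS (-1) Xint; rewrite addNr => ->.
rewrite pr_eq0 ?add0r// => k /=; rewrite in_itv/= ler_int => k0.
apply/le_anti; rewrite pmfz_ge0 andbT leNgt; apply/negP => /X0; lia.
Qed.

Lemma pr_tail0 d (T : measurableType d) (P : probability T R)
    (X : {RV P >-> R}) : integer_valued X -> (forall k, supp X k -> 0 <= k) ->
  pr X `]0, +oo[ = 1 - pmfz X 0.
Proof.
by move=> Xint X0; rewrite -pr_ray0// -(pr_cdf_ccdf X 0) addrAC subrr add0r.
Qed.

End IntegerLaw.

(** * Orders between two laws with the same support *)

Section CommonSupport.
Context (R : realType) d1 d2 (T1 : measurableType d1) (T2 : measurableType d2)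
  (P : probability T1 R) (Q : probability T2 R)
  (X : {RV P >-> R}) (Y : {RV Q >-> R}) (S : set int).
Hypotheses (Xint : integer_valued X) (Yint : integer_valued Y).
Hypotheses (suppX : supp X = S) (suppY : supp Y = S).

Local Notation f := (pmfz X).
Local Notation g := (pmfz Y).
Local Notation r k := (pmfz X k / pmfz Y k).

Lemma pmfX_gt0 k : S k -> 0 < f k. Proof. by rewrite -suppX. Qed.

Lemma pmfY_gt0 k : S k -> 0 < g k. Proof. by rewrite -suppY. Qed.

Lemma pmfX_eq0 k : ~ S k -> f k = 0.
Proof.
by rewrite -suppX => /negP; rewrite -leNgt => fk; apply/le_anti; rewrite fk pmfz_ge0.
Qed.

Lemma pmfY_eq0 k : ~ S k -> g k = 0.
Proof.
by rewrite -suppY => /negP; rewrite -leNgt => gk; apply/le_anti; rewrite gk pmfz_ge0.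
Qed.

Lemma pr_le_ratio (c : R) (B : set R) : measurable B ->
  (forall k, S k -> B k%:~R -> r k <= c) -> pr X B <= c * pr Y B.
Proof.
move=> mB rc; rewrite -[leLHS]mul1r; apply: pr_le_pr => // k Bk.
have [Sk|Sk] := pselect (S k); last by rewrite pmfX_eq0// pmfY_eq0// !mulr0.
by rewrite mul1r -ler_pdivrMr ?pmfY_gt0// rc.
Qed.

Lemma pr_ge_ratio (c : R) (B : set R) : 0 <= c -> measurable B ->
  (forall k, S k -> B k%:~R -> c <= r k) -> c * pr Y B <= pr X B.
Proof.
move=> c0 mB rc; rewrite -[leRHS]mul1r; apply: pr_le_pr => // k Bk.
have [Sk|Sk] := pselect (S k); last by rewrite pmfX_eq0// pmfY_eq0// !mulr0.
by rewrite mul1r -ler_pdivlMr ?pmfY_gt0// rc.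
Qed.

(** On the support [f = r g], so cancelling [g] leaves a comparison between
    [r x] and the ratio of the tails; the next two lemmas do the same for the
    reversed hazard rate and for the likelihood ratio. *)
Lemma hr_leP : hr_le X Y <-> forall x, S x ->
  r x * pr Y `]x%:~R, +oo[ >= pr X `]x%:~R, +oo[.
Proof.
rewrite /hr_le suppX suppY setIid; split=> h x Sx; have := h x Sx;
  rewrite !ccdfE lee_pdiv_cross ?pr_ge0 ?pmfX_gt0 ?pmfY_gt0//;
  by rewrite mulrAC ler_pdivlMr ?pmfY_gt0// [leLHS]mulrC.
Qed.

Lemma rh_leP : rh_le X Y <-> forall x, S x ->
  r x * pr Y `]-oo, x%:~R] <= pr X `]-oo, x%:~R].
Proof.
rewrite /rh_le suppX suppY setIid; split=> h x Sx; have := h x Sx;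
  rewrite !cdfE lee_pdiv_cross ?pr_ge0 ?pmfX_gt0 ?pmfY_gt0//;
  by rewrite mulrAC ler_pdivrMr ?pmfY_gt0// [leRHS]mulrC.
Qed.

Lemma lr_leP : lr_le X Y <-> forall x y, S x -> S y -> x <= y -> r y <= r x.
Proof.
rewrite /lr_le suppX suppY setUid; split=> h x y Sx Sy xy; have := h x y Sx Sy xy;
  rewrite lee_pdiv_cross ?pmfX_gt0 ?pmfz_ge0//;
  by rewrite ler_pdivrMr ?pmfY_gt0// mulrAC ler_pdivlMr ?pmfY_gt0.
Qed.

Lemma st_leP : st_le X Y <-> forall x : R, pr X `]x, +oo[ <= pr Y `]x, +oo[.
Proof. by split=> h x; have := h x; rewrite !ccdfE lee_fin. Qed.

(** Relative log-concavity concerns [ln r]; since [ln] is increasing,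
    monotonicity and quasi-concavity pass from [ln r] to [r]. *)
Lemma ln_ratio_le x y : S x -> S y -> (ln (r x) <= ln (r y)) = (r x <= r y).
Proof.
by move=> Sx Sy; rewrite ler_ln// posrE divr_gt0 ?pmfX_gt0 ?pmfY_gt0.
Qed.

Lemma ratio_nonincreasing x y z : lc_le X Y -> S x -> S (x + 1) -> S z ->
  r (x + 1) <= r x -> x <= y -> y <= z -> r z <= r y.
Proof.
move=> [itvS _ _]; rewrite suppX in itvS * => lc Sx Sx1 Sz rx xy yz.
have Sy : S y by apply: (itvS x z) => //; rewrite xy.
rewrite -ln_ratio_le//.
by apply: (concave_nonincreasing itvS lc Sx Sx1) => //; rewrite ln_ratio_le.
Qed.

Lemma ratio_quasiconcave x y z : lc_le X Y -> S x -> S z ->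
  x <= y -> y <= z -> r y < r z -> r x <= r y.
Proof.
move=> [itvS _ _]; rewrite suppX in itvS * => lc Sx Sz xy yz.
have Sy : S y by apply: (itvS x z) => //; rewrite xy.
rewrite -ln_ratio_le// ltNge -ln_ratio_le// -ltNge.
exact: (concave_quasiconcave itvS lc Sx Sz).
Qed.

(** * Reduction of the orders to the ratio at 0 and 1 *)

Hypotheses (S_ge0 : forall k, S k -> 0 <= k) (S0 : S 0) (S1 : S 1).
Hypothesis lcXY : lc_le X Y.

Lemma st_le_ratio0 : st_le X Y -> 1 <= r 0.
Proof.
move=> /st_leP/(_ 0); rewrite ler_pdivlMr ?pmfY_gt0// mul1r.
rewrite !pr_tail0 ?suppX ?suppY//; lra.
Qed.

(** Beyond [x], either [r] is at most 1 and the tails are compared directly, or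
    [r] exceeds 1 somewhere, hence is at least 1 up to [x] since it is so at
    0. *)
Lemma ratio0_st_le : 1 <= r 0 -> st_le X Y.
Proof.
move=> r0; apply/st_leP => x.
have [h|] := pselect (forall k, S k -> x < k%:~R -> r k <= 1).
  rewrite -[leRHS]mul1r; apply: pr_le_ratio => // k Sk /=.
  by rewrite in_itv/= andbT; exact: h.
move=> /existsNP[z /not_implyP[Sz /not_implyP[xz /negP]]]; rewrite -ltNge => rz.
have : 1 * pr Y `]-oo, x] <= pr X `]-oo, x].
  apply: pr_ge_ratio => // k Sk; rewrite /= in_itv/= => kx.
  rewrite leNgt; apply/negP => rk.
  have kz : k <= z by rewrite -(ler_int R) (le_trans kx)// ltW.
  have rzk := lt_trans rk rz.
  have := le_trans r0 (ratio_quasiconcave lcXY S0 Sz (S_ge0 Sk) kz rzk).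
  by rewrite leNgt rk.
have := pr_cdf_ccdf X x; have := pr_cdf_ccdf Y x; lra.
Qed.

Lemma hr_le_ratio0 : hr_le X Y -> 1 <= r 0.
Proof.
move=> /hr_leP/(_ 0 S0); rewrite [_ <= r 0]ler_pdivlMr ?pmfY_gt0// mul1r.
rewrite mulrAC ler_pdivlMr ?pmfY_gt0//.
rewrite !pr_tail0 ?suppX ?suppY//; lra.
Qed.

(** If [r] exceeds [r x] somewhere beyond [x], then [r x] is at least
    [r 0 >= 1], and the usual stochastic order already gives more than is
    required at [x]. *)
Lemma ratio0_hr_le : 1 <= r 0 -> hr_le X Y.
Proof.
move=> r0; apply/hr_leP => x Sx.
have [h|] := pselect (forall k, S k -> x < k -> r k <= r x).
  apply: pr_le_ratio => // k Sk /=.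
  by rewrite in_itv/= andbT ltr_int; exact: h.
move=> /existsNP[z /not_implyP[Sz /not_implyP[xz /negP]]]; rewrite -ltNge => rz.
have rx : 1 <= r x.
  exact: le_trans r0 (ratio_quasiconcave lcXY S0 Sz (S_ge0 Sx) (ltW xz) rz).
have /st_leP/(_ x%:~R) XY := ratio0_st_le r0.
by apply: (le_trans XY); rewrite ler_peMl ?pr_ge0.
Qed.

Lemma ratio1_lr_le : r 1 <= r 0 -> lr_le X Y.
Proof.
move=> r10; apply/lr_leP => x y Sx Sy xy.
exact: (ratio_nonincreasing lcXY S0 S1 Sy r10 (S_ge0 Sx) xy).
Qed.

Lemma lr_le_rh_le : lr_le X Y -> rh_le X Y.
Proof.
move=> /lr_leP lr; apply/rh_leP => x Sx; apply: pr_ge_ratio => //.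
  by rewrite divr_ge0 ?pmfz_ge0.
by move=> k Sk; rewrite /= in_itv/= ler_int; exact: lr.
Qed.

(** At [x = 1] the order reads [r 1 * (g 0 + g 1) <= f 0 + f 1]; the terms
    [r 1 * g 1 = f 1] cancel. *)
Lemma rh_le_ratio1 : rh_le X Y -> r 1 <= r 0.
Proof.
move=> /rh_leP/(_ 1 S1).
have := pr_rayS 0 Xint; have := pr_rayS 0 Yint; rewrite add0r => -> ->.
rewrite !pr_ray0 ?suppX ?suppY// mulrDr divfK ?gt_eqF ?pmfY_gt0//.
by rewrite lerD2r => fg; rewrite ler_pdivlMr ?pmfY_gt0.
Qed.

End CommonSupport.

Theorem theorem2 (R : realType) (d1 d2 : measure_display)
    (T1 : measurableType d1) (T2 : measurableType d2)
    (P : probability T1 R) (Q : probability T2 R)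
    (X : {RV P >-> R}) (Y : {RV Q >-> R})
    (Xint : integer_valued X) (Yint : integer_valued Y)
    (S : set int)
    (S_shape : S = [set x : int | 0 <= x] \/
      exists2 n : int, 0 < n & S = [set x : int | 0 <= x <= n])
    (suppX : supp X = S) (suppY : supp Y = S)
    (XY : lc_le X Y) :
  [/\ st_le X Y <-> hr_le X Y,
      st_le X Y <-> 1 <= pmfz X 0 / pmfz Y 0
    & hr_le X Y <-> 1 <= pmfz X 0 / pmfz Y 0] /\
  [/\ lr_le X Y <-> rh_le X Y,
      lr_le X Y <-> pmfz X 1 / pmfz Y 1 <= pmfz X 0 / pmfz Y 0
    & rh_le X Y <-> pmfz X 1 / pmfz Y 1 <= pmfz X 0 / pmfz Y 0].
Proof.
have [S_ge0 S0 S1] : [/\ forall k, S k -> 0 <= k, S 0 & S 1].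
  by case: S_shape => [|[n n0]] ->; split=> //= [k|]; lia.
split.
  have st : st_le X Y <-> 1 <= pmfz X 0 / pmfz Y 0.
    split; first exact: (st_le_ratio0 Xint Yint suppX suppY S_ge0 S0).
    exact: (ratio0_st_le Xint Yint suppX suppY S_ge0 S0 XY).
  have hr : hr_le X Y <-> 1 <= pmfz X 0 / pmfz Y 0.
    split; first exact: (hr_le_ratio0 Xint Yint suppX suppY S_ge0 S0).
    exact: (ratio0_hr_le Xint Yint suppX suppY S_ge0 S0 XY).
  by split=> //; rewrite st hr.
have lr_rh : lr_le X Y -> rh_le X Y by exact: (lr_le_rh_le Xint Yint suppX suppY).
have rh_r : rh_le X Y -> pmfz X 1 / pmfz Y 1 <= pmfz X 0 / pmfz Y 0.
  exact: (rh_le_ratio1 Xint Yint suppX suppY S_ge0 S0 S1).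
have r_lr : pmfz X 1 / pmfz Y 1 <= pmfz X 0 / pmfz Y 0 -> lr_le X Y.
  exact: (ratio1_lr_le suppX suppY S_ge0 S0 S1 XY).
by split; split; auto.
Qed.
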